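(* Neither of the convolution algebras $\ell_1(\mathbb{Z})$ and $\ell_1(\mathbb{Q})$ (of the additive groups $\mathbb{Z}$ and $\mathbb{Q}$) has uniformly open multiplication.
   Context: For an Abelian group $G$ written additively (with no topology), $\ell_1(G)$ is the Banach space of absolutely summable scalar-valued functions on $G$ with norm $\|x\|=\sum_{g\in G}|x(g)|$ and the convolution product $(x\ast y)(t)=\sum_{r+s=t}x(r)y(s)$; the statement is asserted both for real and for complex scalars. A Banach algebra $A$ has uniformly open multiplication if for every $\varepsilon>0$ there is $\delta>0$ such that for all $x,y\in A$ one has $B(xy,\delta)\subseteq B(x,\varepsilon)\cdot B(y,\varepsilon)$, where $B(x,r)$ is the open ball with centre $x$ and radius $r$ and $U\cdot V=\{uv\colon u\in U,v\in V\}$. *)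

(* Defs.v *)
From HB Require Import structures.
From mathcomp Require Import all_boot all_order all_algebra finmap.
From mathcomp Require Import complex.
From mathcomp Require Import boolp classical_sets functions reals topology.
From mathcomp Require Import normedtype summability.

Set Implicit Arguments.
Unset Strict Implicit.
Unset Printing Implicit Defensive.

Import Order.TTheory GRing.Theory Num.Theory.
Import numFieldNormedType.Exports.

Local Open Scope classical_set_scope.
Local Open Scope ring_scope.

(* A normed algebra is presented by a subset [A] of a Z-module [V] together
   with a norm [nrm] and a product [mul] that are only meaningful on [A];
   balls and their products are taken inside [A].  Scalars may be complex, and
   then norms and radii are elements of [K = R[i]], as for the norms of the
   library: there, [0 < e] forces [e] to be real. *)
Definition ball_in (K : numDomainType) (V : zmodType) (A : set V)
    (nrm : V -> K) (x : V) (r : K) : set V :=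
  A `&` ball_ nrm x r.

Definition uniformly_open_mul (K : numDomainType) (V : zmodType) (A : set V)
    (nrm : V -> K) (mul : V -> V -> V) : Prop :=
  forall eps : K, 0 < eps ->
  exists2 delta : K, 0 < delta &
    forall x y : V, A x -> A y ->
      ball_in A nrm (mul x y) delta `<=`
      [set mul u v | u in ball_in A nrm x eps & v in ball_in A nrm y eps].

Section Ell1.
Variables (K : numFieldType) (G : zmodType).
Implicit Types x y : G -> K.

Definition ell1 : set (G -> K) :=
  [set x | exists M : K, forall J : {fset G},
     partial_sum (fun g => `|x g|) J <= M].

(* [sum] is the unordered sum: the limit of the finite partial sums along the
   filter of finite subsets of [G].  For [K] real or complex it converges
   whenever [x] is in [ell1]. *)
Definition ell1_norm x : K := sum (fun g => `|x g| : K^o).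

(* The pairs (r, s) with r + s = t are parametrised by r. *)
Definition convolution x y : G -> K :=
  fun t => sum (fun r => x r * y (t - r) : K^o).

Definition ell1_uniformly_open_mul : Prop :=
  uniformly_open_mul ell1 ell1_norm convolution.

End Ell1.

(* Main.v *)
(** Write [d_g] for the unit mass at [g].  Take
    [x = (d_e + d_-e + d_Ne - d_-Ne) / 2] and
    [y = (d_e + d_-e - d_Ne + d_-Ne) / 2], whose transforms are
    [cos t +- i sin (N t)], and perturb [x * y] to [h = x * y + delta d_0], whose
    transform is bounded below by [delta].  Suppose [h = u * v] with [u], [v]
    close to [x], [y].  A pigeonhole over rapidly decreasing thresholds cuts
    [u], [v] down to their large values, on a set [E] whose size is bounded in
    terms of [delta] alone, while [u * v] changes little in norm; so the
    transform [F] of the truncated [u] is bounded away from 0.  When [N] is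
    large compared with [#|E|], Dirichlet's theorem gives two small shifts of
    [t] that nearly fix all characters from [E]: one moves [t] only, the other
    moves [N t] only.  Along the resulting grid [F] varies slowly and stays
    close to [cos a + i sin b] with [a] over [[0, pi]] and [b] over
    [[- pi / 2, pi / 2]], so a discrete Poincare-Miranda theorem forces [F] to be
    nearly 0 somewhere: a contradiction.  The characters come from an additive
    map [G -> R] taking the value 1, so Z and Q are treated alike. *)
Require Import Defs.
From HB Require Import structures.
From mathcomp Require Import all_boot all_order all_algebra complex reals.
From mathcomp Require Import finmap boolp classical_sets functions topology.
From mathcomp Require Import normedtype summability trigo.
From mathcomp Require Import zify ring lra.

Set Implicit Arguments.
Unset Strict Implicit.
Unset Printing Implicit Defensive.

Import Order.TTheory GRing.Theory Num.Theory.
Import numFieldNormedType.Exports.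

Local Open Scope ring_scope.
Local Open Scope complex_scope.

(** * Sperner parity on a grid and a discrete Poincare-Miranda theorem *)

Definition flip (a b : option bool) : bool :=
  if a is Some x then if b is Some y then x (+) y else false else false.

(** The three colours are [Some true], [Some false] and [None]; [flip] marks the edges joining the
    first two. A closed cycle that misses a colour has an even number of marked edges. *)
Lemma flip_cell (a b c d : option bool) :
  flip a b (+) flip b c (+) flip c d (+) flip d a ->
  {subset [:: Some true; Some false; None] <= [:: a; b; c; d]}.
Proof.
by move: a b c d => [[]|] [[]|] [[]|] [[]|] //= _ z; rewrite !inE => /or3P[]/eqP->.
Qed.

(** Away from [None], [flip] is the exclusive or of two booleans, so the sum telescopes. *)
Lemma flip_sum (l : nat -> option bool) (n : nat) :
  (forall i, (i <= n)%N -> l i != None) ->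
  \big[addb/false]_(i < n) flip (l i) (l i.+1) = flip (l 0) (l n).
Proof.
elim: n => [|n IH] hl.
  by rewrite big_ord0; case: (l 0) => //= b; rewrite addbb.
rewrite big_ord_recr /= IH => [|i /leqW/hl //].
move: (hl 0 isT) (hl n (leqnSn n)) (hl n.+1 (leqnn _)).
by case: (l 0) (l n) (l n.+1) => [[]|] [[]|] [[]|].
Qed.

(* Sperner parity: the number of true-false edges along a horizontal line
   changes between consecutive lines only through a three-coloured cell; it is
   even at the bottom and odd at the top. *)
Lemma grid_sperner (l : nat -> nat -> option bool) (n m : nat) :
  (forall j, (j <= m)%N -> l 0 j = Some true) ->
  (forall j, (j <= m)%N -> l n j != Some true) ->
  (forall i, (i <= n)%N -> l i 0 != Some false) ->
  (forall i, (i <= n)%N -> l i m != None) ->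
  exists i j, [/\ (i < n)%N, (j < m)%N &
    {subset [:: Some true; Some false; None]
       <= [:: l i j; l i.+1 j; l i.+1 j.+1; l i j.+1]}].
Proof.
move=> left right bot top; apply: contrapT => no_cell.
pose row j := \big[addb/false]_(i < n) flip (l i j) (l i.+1 j).
have row0 : row 0 = false.
  rewrite /row big1 // => i _.
  move: (bot i (ltnW (ltn_ord i))) (bot i.+1 (ltn_ord i)).
  by case: (l i 0) (l i.+1 0) => [[]|] [[]|].
have rowm : row m = true.
  rewrite /row (@flip_sum (l ^~ m)) // left //.
  by move: (right m (leqnn m)) (top n (leqnn n)); case: (l n m) => [[]|].
have rowS j : (j < m)%N -> row j.+1 = row j.
  move=> jm; suff: row j (+) row j.+1 = false.
    by case: (row j) (row j.+1) => [] [].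
  (* Without a three-coloured cell, [flip_cell] makes the number of marked edges around each cell
     even. *)
  have cell i : (i < n)%N ->
      flip (l i j) (l i.+1 j) (+) flip (l i j.+1) (l i.+1 j.+1) =
      flip (l i j) (l i j.+1) (+) flip (l i.+1 j) (l i.+1 j.+1).
    move=> ilt; apply/eqP; rewrite -[_ == _]negbK; apply/negP => h.
    apply: no_cell; exists i, j; split => //; apply: flip_cell.
    move: h; move: (l i j) (l i.+1 j) (l i.+1 j.+1) (l i j.+1).
    by move=> [[]|] [[]|] [[]|] [[]|].
  have tel k : (k <= n)%N ->
      \big[addb/false]_(i < k) (flip (l i j) (l i.+1 j) (+)
         flip (l i j.+1) (l i.+1 j.+1)) =
      flip (l 0 j) (l 0 j.+1) (+) flip (l k j) (l k j.+1).
    elim: k => [|k IH] kn; first by rewrite big_ord0 addbb.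
    rewrite big_ord_recr /= IH ?(ltnW kn) // cell //.
    by case: (flip (l 0 j) _) (flip (l k j) _) (flip (l k.+1 j) _) => [] [] [].
  (* Neither end column contributes: the left one is monochrome and the right one lacks
     [Some true]. *)
  rewrite /row -big_split /= tel // !left ?(ltnW jm) //=.
  move: (right j (ltnW jm)) (right j.+1 jm).
  by case: (l n j) (l n j.+1) => [[]|] [[]|].
have rowj j : (j <= m)%N -> row j = false.
  by elim: j => [//|j IH] jm; rewrite rowS // IH // ltnW.
by move: (rowj m (leqnn m)); rewrite rowm.
Qed.

(** Vertices are coloured by signs: [Some true] where [f > 0], [Some false] where [f <= 0 < g],
    [None] elsewhere. Both functions change sign within a three-coloured cell. *)
Lemma grid_poincare_miranda (R : realDomainType) (f g : nat -> nat -> R)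
    (n m : nat) (w : R) :
  (forall j, (j <= m)%N -> 0 < f 0 j) ->
  (forall j, (j <= m)%N -> f n j <= 0) ->
  (forall i, (i <= n)%N -> g i 0 <= 0) ->
  (forall i, (i <= n)%N -> 0 < g i m) ->
  (forall i j, (i < n)%N -> (j <= m)%N ->
     `|f i.+1 j - f i j| <= w /\ `|g i.+1 j - g i j| <= w) ->
  (forall i j, (i <= n)%N -> (j < m)%N ->
     `|f i j.+1 - f i j| <= w /\ `|g i j.+1 - g i j| <= w) ->
  exists i j, [/\ (i <= n)%N, (j <= m)%N, `|f i j| <= 2 * w & `|g i j| <= 2 * w].
Proof.
move=> left right bot top hor ver.
pose l i j := if 0 < f i j then Some true
              else if 0 < g i j then Some false else None.
have [i [j [ilt jlt cell]]] : exists i j, [/\ (i < n)%N, (j < m)%N &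
    {subset [:: Some true; Some false; None]
       <= [:: l i j; l i.+1 j; l i.+1 j.+1; l i j.+1]}].
  apply: grid_sperner => [k|k|k|k] hk; rewrite /l.
  - by rewrite left.
  - by rewrite ltNge right //=; case: ifP.
  - by rewrite [0 < g _ _]ltNge bot //=; case: ifP.
  - by rewrite top //; case: ifP.
pose cells := [:: (i, j); (i.+1, j); (i.+1, j.+1); (i, j.+1)].
(* Two vertices of a cell are at most two edges apart, whence the factor 2. *)
have cellP p q : p \in cells -> q \in cells ->
    `|f p.1 p.2 - f q.1 q.2| <= 2 * w /\ `|g p.1 p.2 - g q.1 q.2| <= 2 * w.
  have [h1 h2] := hor i j ilt (ltnW jlt).
  have [h3 h4] := hor i j.+1 ilt jlt.
  have [h5 h6] := ver i j (ltnW ilt) jlt.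
  have [h7 h8] := ver i.+1 j ilt jlt.
  move: h1 h2 h3 h4 h5 h6 h7 h8; rewrite !ler_norml => h1 h2 h3 h4 h5 h6 h7 h8.
  move: p q => [p1 p2] [q1 q2]; rewrite !inE {left right bot top hor ver cell}.
  by move=> /or4P[] /eqP[-> ->] /or4P[] /eqP[-> ->] /=; split; lra.
have lab c : c \in [:: Some true; Some false; None] ->
    exists2 p, p \in cells & l p.1 p.2 = c.
  move=> /cell; rewrite !inE => /or4P[] /eqP ->.
  - by exists (i, j); rewrite // !inE eqxx.
  - by exists (i.+1, j); rewrite // !inE eqxx ?orbT.
  - by exists (i.+1, j.+1); rewrite // !inE eqxx ?orbT.
  - by exists (i, j.+1); rewrite // !inE eqxx ?orbT.
have [p pc lp] := lab (Some true) isT.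
have [q qc lq] := lab (Some false) isT.
have [r rc lr] := lab None isT.
have [qn qm] : (q.1 <= n)%N /\ (q.2 <= m)%N.
  by move: qc; rewrite !inE => /or4P[] /eqP -> /=; lia.
(* At the [Some false] vertex, [f] is compared with its value at the [Some true] vertex and [g] with
   its value at the [None] vertex. *)
exists q.1, q.2; split => //.
- have [+ _] := cellP _ _ pc qc; move: lp lq; rewrite /l.
  by do 2 (case: ifP => //); rewrite !ler_norml; lra.
- have [_ +] := cellP _ _ rc qc; move: lr lq; rewrite /l.
  by do 4 (case: ifP => //); rewrite !ler_norml; lra.
Qed.

(** * Pigeonhole on increments, and superlevel sets of summable families *)

Lemma small_increment (R : archiFieldType) (s : nat -> R) (W t : R) (K : nat) :
  0 <= s 0 -> s K <= W -> W < t * K%:R ->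
  exists2 k, (k < K)%N & s k.+1 - s k <= t.
Proof.
move=> s0 sK WK; apply: contrapT => none.
have inc k : (k <= K)%N -> t * k%:R <= s k.
  elim: k => [|k IH] kK; first by rewrite mulr0.
  have := IH (ltnW kK); rewrite -natr1 mulrDr mulr1.
  have [//|] := lerP (s k.+1 - s k) t; last lra.
  by move=> h; case: none; exists k.
by have := inc K (leqnn K); lra.
Qed.

Lemma fsum_le (R : numDomainType) (I : choiceType) (A B : {fset I}) (w : I -> R) :
  (forall r, 0 <= w r) -> (A `<=` B)%fset -> \sum_(r <- A) w r <= \sum_(r <- B) w r.
Proof.
move=> w0 /fsubsetP AB; rewrite (big_fsetID _ (mem A) B) /=.
have -> : [fset x in B | x \in A]%fset = A.
  by apply/fsetP => x; rewrite !inE /= andbC; apply: andb_idr => /AB.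
by rewrite lerDl sumr_ge0.
Qed.

(** Chebyshev's inequality bounds the size of every finite part of the superlevel set, so a part of
    largest size exists; by maximality it is the whole set. *)
Lemma superlevel_fset (R : archiFieldType) (I : choiceType) (w : I -> R) (W eta : R) :
  (forall r, 0 <= w r) -> 0 < eta ->
  (forall J : {fset I}, \sum_(r <- J) w r <= W) ->
  exists2 E : {fset I}, #|` E|%:R * eta <= W & forall r, (r \in E) = (eta <= w r).
Proof.
move=> w0 eta0 wW.
have card_le (J : {fset I}) : (forall r, r \in J -> eta <= w r) -> #|` J|%:R * eta <= W.
  move=> hJ; apply: le_trans (wW J).
  rewrite card_fset_sum1 natr_sum mulr_suml [leLHS]big_seq [leRHS]big_seq.
  by apply: ler_sum => r /hJ; rewrite mul1r.
pose P n := `[< exists2 J : {fset I}, #|` J| = n & forall r, r \in J -> eta <= w r >].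
have exP : exists n, P n by exists 0; apply/asboolP; exists fset0%fset; rewrite ?cardfs0.
have Pbound n : P n -> (n <= Num.bound (W / eta))%N.
  move=> /asboolP[J <- /card_le cJ]; rewrite -(ler_nat R).
  apply: le_trans (ltW (archi_boundP _)); first by rewrite ler_pdivlMr.
  by rewrite divr_ge0 ?(ltW eta0) //; apply: le_trans (wW fset0%fset); rewrite sumr_ge0.
case: (ex_maxnP exP Pbound) => n /asboolP[E cE hE] maxE.
exists E; first exact: card_le.
move=> r; apply/idP/idP => [/hE //|hr]; apply/negPn/negP => rE.
suff : (#|` (r |` E)%fset| <= n)%N by rewrite cardfsU1 rE cE add1n ltnn.
apply: maxE; apply/asboolP; exists (r |` E)%fset => // s.
by rewrite !inE => /orP[/eqP->|/hE].
Qed.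

(** * Real-valued moduli, points of the unit circle and simultaneous approximation *)

Section Characters.
Variable R : realType.
Implicit Types (z : R[i]) (t : R).

(** The norm of [R[i]] takes its values in [R[i]]; this is the same modulus with values in [R],
    where real arithmetic is available. *)
Definition nm z : R := Normc.normc z.
Arguments nm : simpl never.

Lemma nmE z : (nm z)%:C = `|z|. Proof. by []. Qed.

Lemma nm_ge0 z : 0 <= nm z. Proof. by rewrite -ler0c nmE. Qed.

Lemma nm0 : nm 0 = 0. Proof. by apply: complexI; rewrite nmE normr0. Qed.

Lemma nm_real t : nm t%:C = `|t|.
Proof. by rewrite /nm /= expr0n /= addr0 sqrtr_sqr. Qed.

Lemma nmM z z' : nm (z * z') = nm z * nm z'.
Proof. by apply: complexI; rewrite rmorphM /= !nmE normrM. Qed.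

Lemma ler_nmD z z' : nm (z + z') <= nm z + nm z'.
Proof. by rewrite -lecR rmorphD /= !nmE ler_normD. Qed.

Lemma nmN z : nm (- z) = nm z.
Proof. by apply: complexI; rewrite !nmE normrN. Qed.

Lemma nm_distC z z' : nm (z - z') = nm (z' - z).
Proof. by rewrite -nmN opprB. Qed.

Lemma ler_nm_sum (I : Type) (r : seq I) (F : I -> R[i]) :
  nm (\sum_(i <- r) F i) <= \sum_(i <- r) nm (F i).
Proof.
elim/big_ind2: _ => [|a b c d h1 h2|//]; first by rewrite nm0.
exact: le_trans (ler_nmD _ _) (lerD h1 h2).
Qed.

Lemma Re_le_nm z : `|complex.Re z| <= nm z.
Proof. by rewrite -lecR nmE normc_ge_Re. Qed.

Lemma Im_le_nm z : `|complex.Im z| <= nm z.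
Proof.
have := Re_le_nm (z * 'i); rewrite ReiNIm normrN nmM.
by rewrite [X in _ * X](_ : _ = 1) ?mulr1 // /nm /= expr0n /= expr1n add0r sqrtr1.
Qed.

Lemma nm_le_ReIm z : nm z <= `|complex.Re z| + `|complex.Im z|.
Proof.
rewrite {1}[z]complexE; apply: le_trans (ler_nmD _ _) _.
rewrite nmM !nm_real [X in X * _](_ : _ = 1) ?mul1r //.
by rewrite /nm /= expr0n /= expr1n add0r sqrtr1.
Qed.

Definition cexp t : R[i] := cos t +i* sin t.
Arguments cexp : simpl never.

Lemma cexpD t t' : cexp (t + t') = cexp t * cexp t'.
Proof.
rewrite /cexp cosD sinD; apply/eqP; rewrite eq_complex /=.
by rewrite eqxx /= addrC.
Qed.

Lemma cexp0 : cexp 0 = 1.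
Proof. by rewrite /cexp cos0 sin0. Qed.

Lemma nm_cexp t : nm (cexp t) = 1.
Proof. by rewrite /nm /= cos2Dsin2 sqrtr1. Qed.

Lemma close_cexpB t t' : nm (cexp (t - t') - 1) = nm (cexp t - cexp t').
Proof.
have -> : cexp t = cexp (t - t') * cexp t' by rewrite -cexpD subrK.
by rewrite -[X in _ * _ - X]mul1r -mulrBl nmM nm_cexp mulr1.
Qed.

(* Dirichlet's pigeonhole argument, with boxes for the pairs (cos, sin). *)
Lemma simultaneous_return (L : nat) (E : seq R) : (0 < L)%N ->
  exists2 k, (0 < k <= ((L.*2.+1 * L.*2.+1) ^ size E))%N &
    forall s, s \in E -> nm (cexp (k%:R * s) - 1) <= 2 / L%:R.
Proof.
move=> L0; have LR : 0 < L%:R :> R by rewrite ltr0n.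
(* Boxes have side [1 / L]. On [[-1, 1]] the integer part of [L * (x + 1)] runs from 0 to [2 * L],
   the last value only at [x = 1]; hence [b.+1] boxes. *)
pose b := L.*2.
pose box (x : R) : 'I_b.+1 := inord (Num.truncn (L%:R * (x + 1))).
have boxP (x y : R) : -1 <= x <= 1 -> -1 <= y <= 1 -> box x = box y ->
    `|x - y| <= L%:R^-1.
  have bx (c : R) : -1 <= c <= 1 -> box c = Num.truncn (L%:R * (c + 1)) :> nat.
    move=> /andP[c1 c2]; rewrite inordK // ltnS -(ler_nat R).
    apply: le_trans (_ : L%:R * (c + 1) <= _).
      by rewrite truncn_le mulr_ge0 ?(ltW LR) //; lra.
    by rewrite /b -muln2 natrM ler_pM2l //; lra.
  move=> hx hy /(congr1 val) /=; rewrite !bx // => e.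
  have itv (c : R) : -1 <= c <= 1 ->
      (Num.truncn (L%:R * (c + 1)))%:R <= L%:R * (c + 1)
        < (Num.truncn (L%:R * (c + 1))).+1%:R.
    by move=> /andP[c1 c2]; apply: truncn_itv; rewrite mulr_ge0 ?(ltW LR) //; lra.
  have := itv x hx; have := itv y hy; rewrite e -natr1.
  move: (_%:R) => T /andP[h1 h2] /andP[h3 h4].
  rewrite -(ler_pM2l LR) divff ?gt_eqF // -{1}(gtr0_norm LR) -normrM ler_norml.
  by apply/andP; split; lra.
pose Phi (k : 'I_((b.+1 * b.+1) ^ size E).+1) :
    {ffun 'I_(size E) -> 'I_b.+1 * 'I_b.+1} :=
  [ffun a : 'I_(size E) => (box (cos (k%:R * E`_a)), box (sin (k%:R * E`_a)))].
have /injectivePn[k [k' neq e]] : ~~ injectiveb Phi.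
  apply/injectiveP => /leq_card; rewrite card_ffun card_prod !card_ord.
  by rewrite ltnn.
wlog ltk : k k' neq e / (k' < k)%N.
  move=> wl; have := neq; rewrite neq_ltn => /orP[h|h].
    by apply: (wl k' k); rewrite // eq_sym.
  exact: (wl k k').
exists (k - k')%N; first by rewrite subn_gt0 ltk /= -ltnS (leq_ltn_trans (leq_subr _ _)).
move=> s sE; have ai : (index s E < size E)%N by rewrite index_mem.
move/ffunP: e => /(_ (Ordinal ai)); rewrite !ffunE /= nth_index // => -[e1 e2].
rewrite natrB ?(ltnW ltk) // mulrBl close_cexpB.
apply: le_trans (nm_le_ReIm _) _.
have cb (u : R) : -1 <= cos u <= 1 by rewrite cos_geN1 cos_le1.
have sb (u : R) : -1 <= sin u <= 1 by rewrite sin_geN1 sin_le1.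
have := boxP _ _ (cb _) (cb _) e1; have := boxP _ _ (sb _) (sb _) e2.
by rewrite /cexp /=; lra.
Qed.

End Characters.
Arguments nm : simpl never.
Arguments cexp : simpl never.

(** * Elementary trigonometry *)

Section Trigonometry.
Variable R : realType.
Implicit Types x : R.

(** Positivity of [cos (2 x)] gives [cos x ^+ 2 > 1 / 2], which is more than needed as [cos x] is
    positive. *)
Lemma cos_near0 x : - (pi / 4) < x < pi / 4 -> 1 / 2 < cos x.
Proof.
move=> /andP[x1 x2]; have p0 := pi_gt0 R.
have c0 : 0 < cos x by apply: cos_gt0_pihalf; apply/andP; split; lra.
have : 0 < cos (x + x) by apply: cos_gt0_pihalf; apply/andP; split; lra.
rewrite cosD; have := cos2Dsin2 x.
by nra.
Qed.

Lemma cos_turns (n : nat) x : cos (x + n%:R * (2 * pi)) = cos x.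
Proof.
have -> : n%:R * (2 * pi) = (pi *+ 2) *+ n :> R.
  by rewrite -[RHS]mulr_natl -[pi *+ 2]mulr_natl.
exact: (periodicn (@cosD2pi R)).
Qed.

Lemma sin_quarter_turns (n : nat) x :
  sin (n%:R * (2 * pi) + (x - pi / 2)) = - cos x.
Proof. by rewrite addrA sinBpihalf [_ + x]addrC cos_turns. Qed.

Lemma cos_pi_sub x : cos (pi - x) = - cos x.
Proof. by rewrite addrC cosDpi cosN. Qed.

End Trigonometry.

(** * Finite Fourier transforms and truncation of convolutions *)

Section Transform.
Variables (R : realType) (G : zmodType) (iota : {additive G -> R}).
Implicit Types (u v : G -> R[i]) (w : G -> R) (t : R) (E P J : {fset G}).

Definition chi t (s : G) : R[i] := cexp (t * iota s).

Lemma chiD t s s' : chi t (s + s') = chi t s * chi t s'.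
Proof. by rewrite /chi raddfD /= mulrDr cexpD. Qed.

Lemma chi_shift t t' s : chi (t + t') s = chi t s * chi t' s.
Proof. by rewrite /chi mulrDl cexpD. Qed.

Lemma nm_chi t s : nm (chi t s) = 1.
Proof. exact: nm_cexp. Qed.

Definition ftrans E u t : R[i] := \sum_(s <- E) u s * chi t s.

Lemma nm_ftransB E u v t :
  nm (ftrans E u t - ftrans E v t) <= \sum_(s <- E) nm (u s - v s).
Proof.
rewrite /ftrans -sumrB; apply: le_trans (ler_nm_sum _ _) _.
by apply: ler_sum => s _; rewrite -mulrBl nmM nm_chi mulr1.
Qed.

Lemma nm_ftrans E u t : nm (ftrans E u t) <= \sum_(s <- E) nm (u s).
Proof.
apply: le_trans (ler_nm_sum _ _) _.
by apply: ler_sum => s _; rewrite nmM nm_chi mulr1.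
Qed.

Lemma ftrans_step E u t t' e :
  (forall s, s \in E -> nm (cexp (t' * iota s) - 1) <= e) ->
  nm (ftrans E u (t + t') - ftrans E u t) <= (\sum_(s <- E) nm (u s)) * e.
Proof.
move=> he; rewrite /ftrans -sumrB; apply: le_trans (ler_nm_sum _ _) _.
rewrite mulr_suml big_seq [leRHS]big_seq; apply: ler_sum => s sE.
rewrite chi_shift mulrA -{2}[u s * _]mulr1 -mulrBr !nmM nm_chi mulr1.
by apply: ler_wpM2l; [exact: nm_ge0|exact: he].
Qed.

Lemma sum_translate (V : nmodType) (f : G -> V) (g : G -> G) P : injective g ->
  \sum_(p <- P) f (g p) = \sum_(q <- [fset g p | p in P]%fset) f q.
Proof. by move=> gI; rewrite big_imfset //= => a b _ _ /gI. Qed.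

(** Multiplicativity of [chi t] turns convolution into a product. For each [r] in [E] the translate
    of [P] by [- r] contains [E], so no value of [v] is lost. *)
Lemma ftrans_conv E P u v t :
  (forall r, r \notin E -> v r = 0) ->
  (forall r s, r \in E -> s \in E -> r + s \in P) ->
  ftrans P (fun p => \sum_(r <- E) u r * v (p - r)) t
    = ftrans E u t * ftrans E v t.
Proof.
move=> v0 EP; rewrite /ftrans mulr_suml.
under eq_bigr do rewrite mulr_suml.
rewrite exchange_big /= big_seq [RHS]big_seq; apply: eq_bigr => r rE.
have rI : injective (fun s : G => s - r) by move=> a b /addIr.
transitivity (\sum_(p <- P) u r * chi t r * (v (p - r) * chi t (p - r))).
  apply: eq_bigr => p _.
  by rewrite -[in LHS](subrK r p) [in LHS]chiD addrK; ring.
rewrite -mulr_sumr; congr (_ * _).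
rewrite (@sum_translate _ (fun q => v q * chi t q) _ P rI).
apply/esym/big_fset_incl => [|x _ /v0 ->]; last by rewrite mul0r.
apply/fsubsetP => s sE; apply/imfsetP; exists (s + r); last by rewrite addrK.
by rewrite addrC; exact: EP.
Qed.

Definition cutoff E u : G -> R[i] := fun r => if r \in E then u r else 0.

(** A term changes only if [r] or [p - r] lies outside [E]. There [w] is either in the shell between
    [E] and [E'], of mass at most [tau], or at most [eta]. *)
Lemma conv_truncation_error w u v (W tau eta : R) E E' P J :
  (forall r, nm (u r) <= w r) -> (forall r, nm (v r) <= w r) ->
  (forall K : {fset G}, \sum_(r <- K) w r <= W) ->
  (E `<=` E')%fset ->
  \sum_(r <- E') w r - \sum_(r <- E) w r <= tau ->
  0 <= eta -> (forall r, r \notin E' -> w r <= eta) ->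
  \sum_(p <- P) \sum_(r <- J) nm (u r * v (p - r) - cutoff E u r * cutoff E v (p - r))
    <= 2 * (W * tau) + 2 * (W * eta * #|` P|%:R).
Proof.
move=> uw vw wW EE' mid eta0 small.
have w0 r : 0 <= w r by apply: le_trans (nm_ge0 _) (uw r).
have W0 : 0 <= W by apply: le_trans (wW fset0); apply: sumr_ge0.
(* The part of [w] on the shell. *)
pose w2 r := if (r \in E') && (r \notin E) then w r else 0.
have w2_0 r : 0 <= w2 r by rewrite /w2; case: ifP.
have w2_sum (K : {fset G}) : \sum_(r <- K) w2 r <= tau.
  apply: le_trans mid; rewrite (big_fsetID _ (mem E) E') /=.
  have -> : [fset r in E' | r \in E]%fset = E.
    apply/fsetP => r; rewrite !inE /= andbC; apply: andb_idr.
    by move/fsubsetP: EE'; apply.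
  rewrite [leRHS]addrAC subrr add0r.
  have -> : \sum_(r <- K) w2 r = \sum_(r <- K | (r \in E') && (r \notin E)) w r.
    by rewrite [RHS]big_mkcond.
  rewrite big_fset_condE; apply: fsum_le => //; apply/fsubsetP => r.
  by rewrite !inE /= => /andP[].
have tau0 : 0 <= tau by apply: le_trans (w2_sum fset0); apply: sumr_ge0.
have wle r : r \notin E -> w r <= w2 r + eta.
  move=> rE; rewrite /w2 rE andbT; case: ifP => [_|/negbT /small].
    by rewrite lerDl.
  by rewrite add0r.
have wtrans (g : G -> G) (K : {fset G}) : injective g -> \sum_(p <- K) w (g p) <= W.
  by move=> gI; rewrite sum_translate.
have w2trans (g : G -> G) (K : {fset G}) : injective g -> \sum_(p <- K) w2 (g p) <= tau.
  by move=> gI; rewrite sum_translate.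
have subI (r : G) : injective (fun p => p - r) by move=> a b /addIr.
have subI' (p : G) : injective (fun r => p - r) by move=> a b /addrI /oppr_inj.
pose bnd p r := (w2 r * w (p - r) + w r * w2 (p - r)) +
                (eta * w (p - r) + eta * w r).
apply: (@le_trans _ _ (\sum_(p <- P) \sum_(r <- J) bnd p r)).
  apply: ler_sum => p _; apply: ler_sum => r _; rewrite /bnd /cutoff.
  have prod0 : nm (u r * v (p - r)) <= w r * w (p - r).
    by rewrite nmM; apply: ler_pM; rewrite ?nm_ge0.
  have := w0 r; have := w0 (p - r); have := w2_0 r; have := w2_0 (p - r).
  have [rE|/wle hr] := boolP (r \in E); last first.
    by rewrite mul0r subr0; nra.
  have [prE|/wle hr] := boolP (p - r \in E); last first.
    by rewrite mulr0 subr0; nra.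
  move=> *; rewrite subrr nm0.
  by rewrite !addr_ge0 // mulr_ge0.
under eq_bigr do rewrite !big_split /=.
rewrite !big_split /= mulrDl mul1r mulrDl mul1r.
do 2 apply: lerD.
(* In the two shell terms, summing over [p] first gives a bound independent of [P]. The two [eta]
   terms are bounded for each [p] separately, at the cost of the size of [P]. *)
- rewrite exchange_big /=.
  apply: (@le_trans _ _ (\sum_(r <- J) w2 r * W)).
    by apply: ler_sum => r _; rewrite -mulr_sumr ler_wpM2l // wtrans.
  by rewrite -mulr_suml mulrC ler_wpM2l.
- rewrite exchange_big /=.
  apply: (@le_trans _ _ (\sum_(r <- J) w r * tau)).
    by apply: ler_sum => r _; rewrite -mulr_sumr ler_wpM2l // w2trans.
  by rewrite -mulr_suml ler_wpM2r.
- apply: (@le_trans _ _ (\sum_(p <- P) eta * W)).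
    by apply: ler_sum => p _; rewrite -mulr_sumr ler_wpM2l // wtrans.
  by rewrite big_const_seq count_predT iter_addr_0 [eta * W]mulrC mulr_natr.
- apply: (@le_trans _ _ (\sum_(p <- P) eta * W)).
    by apply: ler_sum => p _; rewrite -mulr_sumr ler_wpM2l.
  by rewrite big_const_seq count_predT iter_addr_0 [eta * W]mulrC mulr_natr.
Qed.

End Transform.

(** * Sign changes of an almost periodic transform along a grid of angles *)

Lemma floor_multiple (R : realDomainType) (n k : nat) (T : R) :
  (0 < k)%N -> k%:R <= T ->
  n%:R - 2 * T <= (2 * k%:R * (n %/ (2 * k))%:R : R) <= n%:R.
Proof.
move=> k0 kT; have h := divn_eq n (2 * k).
have r : (n %% (2 * k) <= 2 * k)%N by rewrite ltnW // ltn_pmod ?muln_gt0.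
move: (congr1 (fun x => x%:R : R) h); rewrite natrD !natrM => e.
have : (n %% (2 * k))%:R <= 2 * k%:R :> R by rewrite -natrM ler_nat.
have : 0 <= (n %% (2 * k))%:R :> R by [].
move: e; move: ((n %% (2 * k))%N%:R) ((n %/ (2 * k))%N%:R) => x y e x0 x1.
have -> : 2 * k%:R * y = n%:R - x by rewrite e; ring.
by lra.
Qed.

Section Contradiction.
Variables (R : realType) (G : zmodType) (iota : {additive G -> R}).

(* The angles theta i j below are chosen so that N theta modulo 2 pi depends on
   j only, while theta itself is essentially a function of i. *)
Lemma grid_contradiction (E : {fset G}) (f : G -> R[i]) (W m : R) (L D : nat) :
  let N := (12 * D)%N in
  (0 < L)%N -> (0 < D)%N -> (((L.*2.+1 * L.*2.+1) ^ #|` E|) <= D)%N ->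
  \sum_(s <- E) nm (f s) <= W -> 8 * W / L%:R < m ->
  (forall t, m <= nm (ftrans iota E f t)) ->
  (forall t, nm (ftrans iota E f t - (cos t +i* sin (N%:R * t))) <= 1 / 4) ->
  False.
Proof.
move=> N L0 D0 hD fW Wm lower close.
have LR : 0 < L%:R :> R by rewrite ltr0n.
have DR : 1 <= D%:R :> R by rewrite ler1n.
have NR : N%:R = 12 * D%:R :> R by rewrite natrM.
have N0 : 0 < N%:R :> R by lra.
have p0 := pi_gt0 R.
pose a : R := 2 * pi / N%:R.
have return_time (c : R) : exists2 k, (0 < k <= D)%N &
    forall s, s \in E -> nm (cexp (k%:R * c * iota s) - 1) <= 2 / L%:R.
  have [k /andP[k0 kD] hk] := simultaneous_return [seq c * iota s | s <- E] L0.
  exists k; first by rewrite k0 (leq_trans kD) // size_map.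
  by move=> s sE; rewrite -mulrA; apply: hk; apply: map_f.
(* Adding [k%:R * a] to [t] turns [N%:R * t] by [k] full turns, so only [t] moves. Adding
   [d%:R * (a / N%:R)] turns [N%:R * t] by [2 * pi * d / N] and moves [t] itself [N] times less. *)
have [k /andP[k0 kD] hk] := return_time a.
have [d /andP[d0 dD] hd] := return_time (a / N%:R).
have kD' : k%:R <= D%:R :> R by rewrite ler_nat.
have dD' : d%:R <= D%:R :> R by rewrite ler_nat.
(* Since [k] and [d] are at most [D = N / 12], rounding loses at most [N / 6]. The far ends of the
   grid then fall within [pi / 4] of their targets, as [cos_near0] requires. *)
pose n1 := (N %/ (2 * k))%N; pose n2 := (N %/ (2 * d))%N.
have hn1 : N%:R - N%:R / 6 <= (2 * k%:R * n1%:R : R) <= N%:R.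
  by have := floor_multiple N k0 kD'; rewrite -/n1; lra.
have hn2 : N%:R - N%:R / 6 <= (2 * d%:R * n2%:R : R) <= N%:R.
  by have := floor_multiple N d0 dD'; rewrite -/n2; lra.
pose theta (i j : nat) : R :=
  pi / N%:R * (2 * k%:R * i%:R + 2 * d%:R * j%:R / N%:R - 1 / 2).
have thetaS1 i j : theta i.+1 j = theta i j + k%:R * a.
  by rewrite /theta /a -natr1; field; lra.
have thetaS2 i j : theta i j.+1 = theta i j + d%:R * (a / N%:R).
  by rewrite /theta /a -natr1; field; lra.
have Ntheta i j : N%:R * theta i j =
    (k * i)%:R * (2 * pi) + (pi * (2 * d%:R * j%:R / N%:R) - pi / 2).
  by rewrite /theta natrM; field; lra.
have n2_le j : (j <= n2)%N -> 0 <= (2 * d%:R * j%:R / N%:R : R) <= 1.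
  move=> jn; have jR : j%:R <= n2%:R :> R by rewrite ler_nat.
  rewrite divr_ge0 ?mulr_ge0 ?(ltW N0) //= ler_pdivrMr // mul1r.
  have /andP[_ /(le_trans _)] := hn2; apply.
  by rewrite ler_wpM2l // mulr_ge0.
pose F i j := ftrans iota E f (theta i j).
have ReF i j : `|complex.Re (F i j) - cos (theta i j)| <= 1 / 4.
  apply: le_trans (close (theta i j)); apply: le_trans (Re_le_nm _).
  by rewrite -/(F i j); case: (F i j).
have ImF i j : `|complex.Im (F i j) - sin (N%:R * theta i j)| <= 1 / 4.
  apply: le_trans (close (theta i j)); apply: le_trans (Im_le_nm _).
  by rewrite -/(F i j); case: (F i j).
have step (x y : nat * nat) : nm (F x.1 x.2 - F y.1 y.2) <= 2 * W / L%:R ->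
    `|complex.Re (F x.1 x.2) - complex.Re (F y.1 y.2)| <= 2 * W / L%:R /\
    `|complex.Im (F x.1 x.2) - complex.Im (F y.1 y.2)| <= 2 * W / L%:R.
  move=> h; split.
    apply: le_trans h; apply: le_trans (Re_le_nm _).
    by case: (F x.1 x.2) (F y.1 y.2) => ? ? [].
  apply: le_trans h; apply: le_trans (Im_le_nm _).
  by case: (F x.1 x.2) (F y.1 y.2) => ? ? [].
have stepW (t b : R) : (forall s, s \in E -> nm (cexp (b * iota s) - 1) <= 2 / L%:R) ->
    nm (ftrans iota E f (t + b) - ftrans iota E f t) <= 2 * W / L%:R.
  move=> hb; apply: le_trans (ftrans_step _ _ hb) _.
  rewrite [2 * W]mulrC -mulrA; apply: ler_wpM2r fW.
  by rewrite divr_ge0 ?(ltW LR).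
have [i [j [_ _ h1 h2]]] : exists i j, [/\ (i <= n1)%N, (j <= n2)%N,
    `|complex.Re (F i j)| <= 2 * (2 * W / L%:R) &
    `|complex.Im (F i j)| <= 2 * (2 * W / L%:R)].
  apply: (@grid_poincare_miranda _ (fun i j => complex.Re (F i j))
    (fun i j => complex.Im (F i j))).
  (* On each side of the grid the model value exceeds 1/2 in absolute value, so an error of 1/4
     preserves its sign. *)
  - move=> j /n2_le jn.
    suff : (1 / 2 : R) < cos (theta 0 j) by have := ReF 0 j; rewrite ler_norml; lra.
    apply: cos_near0.
    have -> : theta 0 j = pi / 4 * ((4 * (2 * d%:R * j%:R / N%:R) - 2) / N%:R).
      by rewrite /theta; field; lra.
    move: (_ / N%:R) jn => x jn.
    have hx : - 1 < (4 * x - 2) / N%:R < 1.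
      by rewrite ltr_pdivlMr // ltr_pdivrMr //; lra.
    by move: (_ / N%:R) hx => y hx; nra.
  - move=> j /n2_le jn.
    suff : (1 / 2 : R) < cos (pi - theta n1 j).
      by rewrite cos_pi_sub; have := ReF n1 j; rewrite ler_norml; lra.
    apply: cos_near0.
    have -> : pi - theta n1 j = pi / 4 * ((4 * (N%:R - 2 * k%:R * n1%:R) + 2
        - 4 * (2 * d%:R * j%:R / N%:R)) / N%:R).
      by rewrite /theta; field; lra.
    move: (_ * j%:R / N%:R) jn => x jn.
    have hx : - 1 < (4 * (N%:R - 2 * k%:R * n1%:R) + 2 - 4 * x) / N%:R < 1.
      by rewrite ltr_pdivlMr // ltr_pdivrMr //; lra.
    by move: (_ / N%:R) hx => y hx; nra.
  - move=> i _.
    have := ImF i 0; rewrite Ntheta mulr0 mul0r mulr0 sin_quarter_turns cos0.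
    by rewrite ler_norml; lra.
  - move=> i _.
    have := ImF i n2; rewrite Ntheta sin_quarter_turns -cos_pi_sub.
    suff : (1 / 2 : R) < cos (pi - pi * (2 * d%:R * n2%:R / N%:R)).
      by rewrite ler_norml; lra.
    apply: cos_near0.
    have hx : 5 / 6 <= (2 * d%:R * n2%:R / N%:R : R) <= 1.
      by rewrite ler_pdivlMr // ler_pdivrMr //; lra.
    by move: (_ / N%:R) hx => y hx; nra.
  - move=> i j _ _; apply: (step (i.+1, j) (i, j)).
    by rewrite /F /= thetaS1; apply: stepW.
  - move=> i j _ _; apply: (step (i, j.+1) (i, j)).
    by rewrite /F /= thetaS2; apply: stepW.
(* Real and imaginary parts are each at most [4 * W / L], so the modulus is at most
   [8 * W / L < m]. *)
have := lower (theta i j); have := nm_le_ReIm (F i j); rewrite -/(F i j).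
by move: (L%:R^-1) Wm h1 h2 => x; lra.
Qed.

End Contradiction.

(** * The two factors and their transforms *)

Section Wave.

(** The factors [x] and [y] are the cases [c = 1] and [c = -1]. The field is arbitrary so that a
    wave over the scalars can be mapped to one over [R[i]]. *)
Definition wave (K : fieldType) (G : zmodType) (e : G) (N : nat) (c : K) (g : G) : K :=
  ((g == e)%:R + (g == - e)%:R +
   c * ((g == e *+ N)%:R - (g == - (e *+ N))%:R)) / 2.

Definition wave_supp (G : zmodType) (e : G) (N : nat) : {fset G} :=
  [fset e; - e; e *+ N; - (e *+ N)]%fset.

Lemma wave_out (K : fieldType) (G : zmodType) (e : G) (N : nat) (c : K) (g : G) :
  g \notin wave_supp e N -> wave e N c g = 0.
Proof.
rewrite !inE !negb_or -!andbA => /and4P[/negbTE h1 /negbTE h2 /negbTE h3 /negbTE h4].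
by rewrite /wave h1 h2 h3 h4 subrr mulr0 !addr0 mul0r.
Qed.

Lemma sum_delta (A : pzRingType) (I : choiceType) (E : {fset I}) (a : I) (F : I -> A) :
  a \in E -> \sum_(s <- E) (s == a)%:R * F s = F a.
Proof.
move=> aE; rewrite (big_fsetD1 a) //= eqxx mul1r big_seq big1 ?addr0 // => s.
by rewrite !inE => /andP[/negbTE -> _]; rewrite mul0r.
Qed.

Lemma sum_indic_le1 (A : numDomainType) (I : choiceType) (J : {fset I}) (a : I) :
  \sum_(s <- J) (s == a)%:R <= 1 :> A.
Proof.
have [aJ|aJ] := boolP (a \in J).
  under eq_bigr do rewrite -[_%:R]mulr1.
  by rewrite sum_delta.
rewrite big_seq big1 // => s sJ; rewrite (_ : s == a = false) //.
by apply: contraNF aJ => /eqP <-.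
Qed.

Variables (R : realType) (G : zmodType) (iota : {additive G -> R}).
Variables (e : G) (N : nat) (c : R[i]).
Hypotheses (iota_e : iota e = 1) (N1 : (1 < N)%N) (c1 : nm c = 1).

Lemma nm_half (z : R[i]) : nm (z / 2) = nm z / 2.
Proof.
rewrite nmM; congr (_ * _).
have -> : 2^-1 = (2^-1 : R)%:C by rewrite fmorphV rmorph_nat.
by rewrite nm_real ger0_norm // invr_ge0.
Qed.

Lemma nm_nat (n : nat) : nm (n%:R : R[i]) = n%:R.
Proof. by rewrite -(rmorph_nat (real_complex R)) nm_real normr_nat. Qed.

Lemma sum_wave_le (J : {fset G}) : \sum_(r <- J) nm (wave e N c r) <= 2.
Proof.
apply: (@le_trans _ _ (\sum_(r <- J) ((r == e)%:R + (r == - e)%:R +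
   ((r == e *+ N)%:R + (r == - (e *+ N))%:R)) / 2)).
  apply: ler_sum => r _; rewrite /wave nm_half ler_wpM2r ?invr_ge0 //.
  apply: le_trans (ler_nmD _ _) _; apply: lerD.
    by apply: le_trans (ler_nmD _ _) _; rewrite !nm_nat.
  rewrite nmM c1 mul1r.
  by apply: le_trans (ler_nmD _ _) _; rewrite nmN !nm_nat.
rewrite -mulr_suml !big_split /=.
have h a := sum_indic_le1 R J a.
by have := h e; have := h (- e); have := h (e *+ N); have := h (- (e *+ N)); lra.
Qed.

Lemma sum_near_wave_le (u : G -> R[i]) (J : {fset G}) :
  \sum_(r <- J) nm (u r - wave e N c r) <= 1 / 4 -> \sum_(r <- J) nm (u r) <= 5 / 2.
Proof.
move=> hu; have := lerD hu (sum_wave_le J); rewrite -big_split /= => h.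
apply: le_trans (_ : 1 / 4 + 2 <= _); last by lra.
apply: le_trans h; apply: ler_sum => r _.
by rewrite -{1}[u r](subrK (wave e N c r)) ler_nmD.
Qed.

(** The four masses do not overlap, because [iota] takes the distinct values 1, -1, N and -N at
    their positions. *)
Lemma wave_on (g : G) : g \in wave_supp e N -> nm (wave e N c g) = 1 / 2.
Proof.
have NR : 2 <= N%:R :> R by rewrite ler_nat.
have iN : iota (e *+ N) = N%:R by rewrite raddfMn /= iota_e.
have neq (a b : G) : iota a != iota b -> (a == b) = false.
  by apply: contraNF => /eqP ->.
have neqs : ((e == - e) = false) * ((e == e *+ N) = false) *
    ((e == - (e *+ N)) = false) * ((- e == e *+ N) = false) *
    ((- e == - (e *+ N)) = false) * ((e *+ N == - (e *+ N)) = false).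
  by do !split; apply: neq; rewrite ?raddfN /= ?iN ?iota_e; apply/eqP; lra.
rewrite !inE -!orbA => /or4P[] /eqP ->; rewrite /wave ?eqxx ?neqs
  ?[- e == e]eq_sym ?[- (e *+ N) == e *+ N]eq_sym ?[- (e *+ N) == - e]eq_sym
  ?[- (e *+ N) == e]eq_sym ?[e *+ N == - e]eq_sym ?[e *+ N == e]eq_sym ?neqs nm_half;
  rewrite ?subrr ?subr0 ?sub0r ?mulr0 ?mulr1 ?mulrN1 ?addr0 ?add0r ?nmN ?c1 //.
all: by rewrite (nm_nat 1).
Qed.

Lemma ftrans_wave (E : {fset G}) (t : R) : (wave_supp e N `<=` E)%fset ->
  ftrans iota E (wave e N c) t = (cos t)%:C + c * (0 +i* sin (N%:R * t)).
Proof.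
move=> /fsubsetP sE.
have -> : ftrans iota E (wave e N c) t =
  (chi iota t e + chi iota t (- e) +
    c * (chi iota t (e *+ N) - chi iota t (- (e *+ N)))) / 2.
  transitivity (\sum_(s <- E) ((s == e)%:R * chi iota t s
      + (s == - e)%:R * chi iota t s + c * ((s == e *+ N)%:R * chi iota t s
      - (s == - (e *+ N))%:R * chi iota t s)) / 2).
    by apply: eq_bigr => s _; rewrite /wave; ring.
  rewrite -mulr_suml !big_split /= -mulr_sumr sumrB.
  by rewrite !sum_delta //; apply: sE; rewrite !inE eqxx ?orbT.
have iN : iota (e *+ N) = N%:R by rewrite raddfMn /= iota_e.
rewrite /chi !raddfN /= iN iota_e !mulrN !mulr1 [t * _]mulrC.
have -> : cexp t + cexp (- t) = 2 * (cos t)%:C.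
  rewrite /cexp cosN sinN mulr2n mulrDl !mul1r; apply/eqP.
  by rewrite eq_complex /= subrr addr0 !eqxx.
have -> (x : R) : cexp x - cexp (- x) = 2 * (0 +i* sin x).
  rewrite /cexp cosN sinN mulr2n mulrDl !mul1r; apply/eqP.
  by rewrite eq_complex /= opprK subrr addr0 !eqxx.
by field.
Qed.

End Wave.

(** * Rapidly decreasing thresholds *)

Section Thresholds.
Variables (R : realFieldType) (c : R).

(** The square compensates the size of the sumset of the superlevel set at level [k], at most a
    constant over [threshold k ^+ 2]. The start 1/4 is what a perturbation of 1/4 leaves of the wave
    value 1/2. *)
Fixpoint threshold (k : nat) : R :=
  if k is k'.+1 then c * threshold k' ^+ 2 else 1 / 4.

Hypothesis c01 : 0 < c <= 1.

Lemma threshold_itv k : 0 < threshold k <= 1 / 4.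
Proof.
have /andP[c0 c1] := c01.
elim: k => [|k /andP[IH1 IH2]] /=; first by lra.
rewrite mulr_gt0 ?exprn_gt0 //= (le_trans _ IH2) // -[leRHS]mul1r.
by rewrite expr2 mulrA ler_wpM2r ?(ltW IH1) //; nra.
Qed.

Lemma threshold_nincr k l : (k <= l)%N -> threshold l <= threshold k.
Proof.
elim: l => [|l IH]; first by rewrite leqn0 => /eqP ->.
rewrite leq_eqVlt => /predU1P[-> //|/IH]; apply: le_trans => /=.
have /andP[l0 l1] := threshold_itv l; have /andP[c0 c1] := c01.
by rewrite -[leRHS]mul1r expr2 mulrA ler_wpM2r ?(ltW l0) //; nra.
Qed.

End Thresholds.

(** * From a factorization with close factors to the grid contradiction *)

Lemma finite_tolerance (A : choiceType) (R : realFieldType)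
    (d : A -> {fset A} -> R) (P : seq A) :
  (forall p rho, 0 < rho -> exists J0, forall J, (J0 `<=` J)%fset -> d p J <= rho) ->
  forall rho, 0 < rho -> exists J0, forall J, (J0 `<=` J)%fset ->
    \sum_(p <- P) d p J <= rho.
Proof.
move=> hd; elim: P => [|p P IH] rho rho0.
  by exists fset0 => J _; rewrite big_nil ltW.
have rho2 : 0 < rho / 2 by lra.
have [J1 h1] := hd p _ rho2; have [J2 h2] := IH _ rho2.
exists (J1 `|` J2)%fset => J; rewrite fsubUset => /andP[/h1 ? /h2 ?].
by rewrite big_cons; lra.
Qed.

(** The choice of [N] precedes the group and the factors. The last hypothesis says that [u * v] is
    [x * y] plus mass [delta] at 0, in terms of partial sums. *)
Lemma no_uniform_factorization (R : realType) (delta : R) : 0 < delta ->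
  exists2 N, (1 < N)%N &
  forall (G : zmodType) (iota : {additive G -> R}) (e : G) (u v : G -> R[i]),
  iota e = 1 ->
  (forall J : {fset G}, \sum_(r <- J) nm (u r - wave e N 1 r) <= 1 / 4) ->
  (forall J : {fset G}, \sum_(r <- J) nm (v r - wave e N (-1) r) <= 1 / 4) ->
  (forall p rho, 0 < rho -> exists J0 : {fset G}, forall J : {fset G},
     (J0 `<=` J)%fset ->
     nm (\sum_(r <- J) u r * v (p - r) -
         (\sum_(r <- wave_supp e N) wave e N 1 r * wave e N (-1) (p - r) +
          (p == 0)%:R * delta%:C)) <= rho) ->
  False.
Proof.
move=> d0.
(* The tail error will be at most [125 * c <= delta / 12]. *)
pose c := Num.min 1 (delta / 1500); have c01 : 0 < c <= 1.
  by rewrite lt_min ge_min lexx ltr01 /= andbT; lra.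
have cd : c <= delta / 1500 by rewrite ge_min lexx orbT.
(* Total mass 5 spread over [K] shells leaves one shell of mass at most [delta / 60]. *)
pose K := (Num.bound (300 / delta)).+1; have HK : 5 < delta / 60 * K%:R.
  have : 300 / delta < K%:R.
    apply: lt_le_trans (archi_boundP _) _; first by rewrite divr_ge0 // ltW.
    by rewrite ler_nat.
  by rewrite ltr_pdivrMr //; lra.
pose L := (Num.bound (400 / delta)).+1; have HL : 8 * 5 / L%:R < delta / 10.
  have : 400 / delta < L%:R.
    apply: lt_le_trans (archi_boundP _) _; first by rewrite divr_ge0 // ltW.
    by rewrite ler_nat.
  by rewrite ltr_pdivrMr // ltr_pdivrMr ?ltr0n //; lra.
(* Bounds the size of every superlevel set used, whichever shell is selected later; thus [D] depends
   on [delta] alone. *)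
pose M := Num.bound (5 / threshold c K).
pose D := ((L.*2.+1 * L.*2.+1) ^ M)%N.
have D0 : (0 < D)%N by rewrite expn_gt0 muln_gt0.
(* Keeps [N] opaque; [ND] restores its value for [grid_contradiction]. *)
have [N ND] : exists N, N = (12 * D)%N by exists (12 * D)%N.
have N1 : (1 < N)%N by rewrite ND (leq_trans _ (leq_pmulr 12 D0)).
exists N => //.
move=> G iota e u v iota_e hu hv hconv.
pose x : G -> R[i] := wave e N 1; pose y : G -> R[i] := wave e N (-1).
have nm1 : nm (1 : R[i]) = 1 by rewrite (nm_nat R 1).
have nmN1 : nm (-1 : R[i]) = 1 by rewrite nmN.
pose w r := nm (u r) + nm (v r).
have w0 r : 0 <= w r by rewrite addr_ge0 ?nm_ge0.
have wW (J : {fset G}) : \sum_(r <- J) w r <= 5.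
  rewrite big_split /= (_ : 5 = (5 / 2 : R) + 5 / 2); last by field.
  apply: lerD.
    exact: (sum_near_wave_le nm1 (hu J)).
  exact: (sum_near_wave_le nmN1 (hv J)).
have tgt0 k : 0 < threshold c k by have /andP[] := threshold_itv c01 k.
have /choice[E HE] k : exists E : {fset G},
    #|` E|%:R * threshold c k <= 5 /\ forall r, (r \in E) = (threshold c k <= w r).
  by have [E] := superlevel_fset w0 (tgt0 k) wW; exists E.
have cE k := (HE k).1; have inE' k := (HE k).2.
have [k kK mid] : exists2 k, (k < K)%N &
    \sum_(r <- E k.+1) w r - \sum_(r <- E k) w r <= delta / 60.
  by apply: (small_increment (W := 5)) => //; apply: sumr_ge0.
have EE : (E k `<=` E k.+1)%fset.
  apply/fsubsetP => r; rewrite !inE'; apply: le_trans.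
  exact: (threshold_nincr c01 (leqnSn k)).
(* On the support of the wave, [u] has modulus at least [1 / 2 - 1 / 4], which is above every
   threshold. *)
have SE : (wave_supp e N `<=` E k)%fset.
  apply/fsubsetP => a aS; rewrite inE'.
  have /andP[_ /le_trans] := threshold_itv c01 k; apply.
  have := hu [fset a]%fset; rewrite big_seq_fset1 => h.
  have := ler_nmD (x a - u a) (u a); rewrite subrK nm_distC /x.
  rewrite (wave_on iota_e N1 nm1 aS) /w; have := nm_ge0 (v a); lra.
pose P := [fset z in [seq (r + s)%R | r <- E k, s <- E k]]%fset.
have EP r s : r \in E k -> s \in E k -> r + s \in P.
  by move=> rE sE; rewrite !inE; apply/allpairsP; exists (r, s).
have cP : #|` P|%:R * threshold c k ^+ 2 <= 25 :> R.
  apply: (@le_trans _ _ ((#|` E k|%:R * threshold c k) ^+ 2)); last first.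
    by rewrite (_ : 25 = 5 ^+ 2) ?lerXn2r ?nnegrE ?mulr_ge0 ?(ltW (tgt0 _)) //; ring.
  rewrite exprMn ler_wpM2r ?sqr_ge0 // -natrX ler_nat.
  by rewrite card_fseq (leq_trans (size_undup _)) // size_allpairs.
have P0 : 0 \in P.
  have sup a : a \in wave_supp e N -> a \in E k by move/fsubsetP: SE; apply.
  by rewrite -(subrr e); apply: EP; apply: sup; rewrite !inE eqxx ?orbT.
pose f := cutoff (E k) u; pose g := cutoff (E k) v.
pose h p := \sum_(r <- E k) x r * y (p - r) + (p == 0)%:R * delta%:C.
have hE p : h p = \sum_(r <- wave_supp e N) x r * y (p - r) + (p == 0)%:R * delta%:C.
  congr (_ + _); apply/esym/big_fset_incl => // r _ /wave_out.
  by rewrite /x => ->; rewrite mul0r.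
have [J1 hJ1] : exists J0 : {fset G}, forall J : {fset G}, (J0 `<=` J)%fset ->
    \sum_(p <- P) nm (\sum_(r <- J) u r * v (p - r) - h p) <= delta / 6.
  apply: (finite_tolerance (d := fun p J => nm (\sum_(r <- J) u r * v (p - r) - h p))).
    by move=> p rho /(hconv p)[J0 HJ]; exists J0 => J /HJ; rewrite hE.
  by lra.
pose J := (J1 `|` E k)%fset.
have EJ : (E k `<=` J)%fset by apply: fsubsetUr.
(* Three contributions of [delta / 6]: the partial sum over [J], the shell and the tail. *)
have err : \sum_(p <- P) nm (\sum_(r <- E k) f r * g (p - r) - h p) <= delta / 2.
  have trunc := @conv_truncation_error R G w u v 5 (delta / 60)
    (threshold c k.+1) (E k) (E k.+1) P J.
  apply: (@le_trans _ _ (\sum_(p <- P) nm (\sum_(r <- J) u r * v (p - r) - h p) +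
     \sum_(p <- P) \sum_(r <- J) nm (u r * v (p - r) - f r * g (p - r)))).
    rewrite -big_split /=; apply: ler_sum => p _.
    have -> : \sum_(r <- E k) f r * g (p - r) = \sum_(r <- J) f r * g (p - r).
      apply: big_fset_incl => // r _; rewrite /f /cutoff => /negbTE ->.
      by rewrite mul0r.
    set A := \sum_(r <- J) f r * _; set B := \sum_(r <- J) u r * _.
    have -> : A - h p = (B - h p) + (A - B) by ring.
    apply: le_trans (ler_nmD _ _) _; rewrite lerD2l nm_distC -sumrB.
    exact: ler_nm_sum.
  have := hJ1 J (fsubsetUl _ _).
  have {}trunc := trunc _ _ wW EE mid (ltW (tgt0 _)).
  have {trunc} := trunc _ _ _.
  rewrite -/f -/g => trunc.
  have : 5 * threshold c k.+1 * #|` P|%:R <= delta / 12.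
    apply: (@le_trans _ _ (125 * c)); last by lra.
    rewrite /= (_ : _ * _ * _ = 5 * c * (#|` P|%:R * threshold c k ^+ 2)); last by ring.
    by case/andP: c01 => c0 _; move: (_ * threshold c k ^+ 2) cP => z cP; nra.
  suff : \sum_(p <- P) \sum_(r <- J) nm (u r * v (p - r) - f r * g (p - r)) <=
    2 * (5 * (delta / 60)) + 2 * (5 * threshold c k.+1 * #|` P|%:R) by lra.
  apply: trunc => [r|r|r]; rewrite /w ?lerDl ?lerDr ?nm_ge0 //.
  by rewrite inE' -ltNge => /ltW.
have vW (J' : {fset G}) : \sum_(r <- J') nm (g r) <= 5.
  apply: le_trans (wW J'); apply: ler_sum => r _; rewrite /w /g /cutoff.
  by case: ifP => _; rewrite ?nm0 ?addr_ge0 ?lerDr ?nm_ge0.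
have uW (J' : {fset G}) : \sum_(r <- J') nm (f r) <= 5.
  apply: le_trans (wW J'); apply: ler_sum => r _; rewrite /w /f /cutoff.
  by case: ifP => _; rewrite ?nm0 ?addr_ge0 ?lerDl ?nm_ge0.
apply: (@grid_contradiction R G iota (E k) f 5 (delta / 10) L D) => //;
  rewrite -?ND.
- apply: leq_pexp2l; first by rewrite muln_gt0.
  rewrite -(ler_nat R); apply: le_trans (ltW (archi_boundP _)).
    rewrite ler_pdivlMr //; apply: le_trans (cE k).
    by rewrite ler_wpM2l // threshold_nincr // ltnW.
  by rewrite divr_ge0 // ltW.
- move=> t.
  have v0 r : r \notin E k -> g r = 0 by rewrite /g /cutoff => /negbTE ->.
  have y0 r : r \notin E k -> y r = 0.
    by move=> rE; apply: wave_out; apply: contra rE; apply/fsubsetP: r.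
  have h1 := @ftrans_conv R G iota (E k) P f g t v0 EP.
  (* The transforms of [x] and [y] are conjugate, so their product is a sum of squares, and the mass
     at 0 adds [delta]. *)
  have h2 : ftrans iota P h t =
      ((cos t) ^+ 2 + (sin (N%:R * t)) ^+ 2 + delta)%:C.
    rewrite /ftrans /h; under eq_bigr do rewrite mulrDl.
    rewrite big_split /= [X in X + _](@ftrans_conv R G iota (E k) P x y t y0 EP).
    rewrite !(ftrans_wave _ iota_e) //.
    under eq_bigr do rewrite -mulrA.
    rewrite sum_delta // /chi raddf0 mulr0 cexp0 mulr1.
    apply/eqP; rewrite eq_complex /=; apply/andP; split; apply/eqP; ring.
  have h3 := nm_ftransB iota P (fun p => \sum_(r <- E k) f r * g (p - r)) h t.
  have h4 : nm (ftrans iota P h t) <=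
    nm (ftrans iota P (fun p => \sum_(r <- E k) f r * g (p - r)) t) + delta / 2.
    set B := ftrans iota P (fun p => \sum_(r <- E k) _) t.
    rewrite -[X in nm X](subrK B) addrC; apply: le_trans (ler_nmD _ _) _.
    by rewrite lerD2l nm_distC (le_trans h3).
  (* The product of the transforms of [f] and [g] has modulus at least [delta / 2], and that of [g]
     at most 5; this leaves [delta / 10] for [f]. *)
  move: h4; rewrite h1 h2 nm_real nmM.
  have := le_trans (nm_ftrans iota (E k) g t) (vW _).
  have := nm_ge0 (ftrans iota (E k) g t); have := nm_ge0 (ftrans iota (E k) f t).
  have s1 := sqr_ge0 (cos t); have s2 := sqr_ge0 (sin (N%:R * t)).
  rewrite ger0_norm; last by lra.
  by move: (nm (ftrans _ _ f t)) (nm (ftrans _ _ g t)) => a b; nra.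
- move=> t.
  have -> : cos t +i* sin (N%:R * t) = ftrans iota (E k) x t.
    rewrite (ftrans_wave _ iota_e) // mul1r; apply/eqP.
    by rewrite eq_complex /= addr0 add0r !eqxx.
  apply: le_trans (nm_ftransB _ _ _ _ _) _; apply: le_trans (hu (E k)).
  rewrite big_seq [leRHS]big_seq; apply: ler_sum => r rE.
  by rewrite /f /cutoff rE.
Qed.

(* Unordered sums over real and complex scalars *)
#[local] Existing Instance totally_filter.

Local Open Scope classical_set_scope.

Section UnorderedSums.
Variables (K : numFieldType) (I : choiceType).
Implicit Types (f : I -> K) (J : {fset I}).

Lemma partial_sumE f J : partial_sum f J = \sum_(r <- J) f r.
Proof. by rewrite /partial_sum big_seq_fsetE. Qed.

Lemma cvg_totallyP (F : {fset I} -> K^o) (l : K^o) :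
  (F @ totally --> l) <->
  (forall eps : K, 0 < eps ->
     exists J0, forall J, (J0 `<=` J)%fset -> `|l - F J| < eps).
Proof.
rewrite cvgrPdist_lt; split => h eps /h.
  by case=> J0 _ HJ; exists J0 => J /HJ.
by case=> J0 HJ; exists J0.
Qed.

Lemma sum_finite_support f (S : {fset I}) :
  (forall r, r \notin S -> f r = 0) -> sum (f : I -> K^o) = \sum_(r <- S) f r.
Proof.
move=> f0; apply: cvg_lim; first exact: norm_hausdorff.
apply/cvg_totallyP => eps eps0; exists S => J SJ.
rewrite partial_sumE (big_fset_incl _ SJ) ?subrr ?normr0 // => r _.
exact: f0.
Qed.

End UnorderedSums.

Definition abs_complete (K : numFieldType) :=
  forall (I : choiceType) (f : I -> K) (M : K),
  (forall J : {fset I}, \sum_(r <- J) `|f r| <= M) ->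
  cvg (partial_sum (f : I -> K^o) @ totally).

(** A nonnegative family converges to the supremum of its partial sums; in general [f] is the
    difference of the nonnegative families [f + |f|] and [|f|]. *)
Lemma abs_complete_real (R : realType) : abs_complete R.
Proof.
have mono (I : choiceType) (g : I -> R) (M : R) : (forall r, 0 <= g r) ->
    (forall J : {fset I}, \sum_(r <- J) g r <= M) ->
    cvg (partial_sum (g : I -> R^o) @ totally).
  move=> g0 gM; pose A := [set \sum_(r <- J) g r | J in @setT {fset I}].
  have supA : has_sup A.
    split; first by exists (\sum_(r <- fset0) g r), fset0.
    by exists M => _ [J _ <-].
  apply/cvg_ex; exists (sup A : R^o); apply/cvg_totallyP => eps eps0.
  have [_ [J0 _ <-] hJ0] := sup_adherent eps0 supA.
  exists J0 => J J0J; rewrite partial_sumE.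
  have := fsum_le g0 J0J.
  have : \sum_(r <- J) g r <= sup A by apply: sup_upper_bound => //; exists J.
  by rewrite ltr_norml; lra.
move=> I f M fM.
have -> : partial_sum (f : I -> R^o) =
   (fun J => partial_sum (fun r => f r + `|f r| : R^o) J
             - partial_sum (fun r => `|f r| : R^o) J).
  apply/funext => J; rewrite !partial_sumE -sumrB.
  by apply: eq_bigr => r _; rewrite addrK.
apply: is_cvgB; last exact: mono fM.
apply: (mono _ _ (M + M)) => [r|J].
  by have := ler_norm (- f r); rewrite normrN; lra.
rewrite big_split /=; apply: lerD => //; apply: le_trans (fM J).
by apply: ler_sum => r _; apply: ler_norm.
Qed.

Lemma abs_complete_complex (R : realType) : abs_complete R[i].
Proof.
move=> I f M fM.
have fM' (J : {fset I}) : \sum_(r <- J) nm (f r) <= complex.Re M.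
  have := fM J; rewrite (eq_bigr (fun r => (nm (f r))%:C)) // -rmorph_sum lecE.
  by case/andP.
have /cvg_ex[a /cvg_totallyP ha] :
    cvg (partial_sum (fun r => complex.Re (f r) : R^o) @ totally).
  apply: (@abs_complete_real R _ _ (complex.Re M)) => J; apply: le_trans (fM' J).
  by apply: ler_sum => r _; apply: Re_le_nm.
have /cvg_ex[b /cvg_totallyP hb] :
    cvg (partial_sum (fun r => complex.Im (f r) : R^o) @ totally).
  apply: (@abs_complete_real R _ _ (complex.Re M)) => J; apply: le_trans (fM' J).
  by apply: ler_sum => r _; apply: Im_le_nm.
apply/cvg_ex; exists (a +i* b : R[i]^o); apply/cvg_totallyP => eps.
(* Positivity in [R[i]] forces the imaginary part of the tolerance to vanish. *)
case: eps => [e e']; rewrite ltcE /= => /andP[/eqP -> e0].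
have e2 : 0 < e / 2 by lra.
have [J1 h1] := ha _ e2; have [J2 h2] := hb _ e2.
exists (J1 `|` J2)%fset => J; rewrite fsubUset => /andP[/h1 + /h2].
rewrite !partial_sumE => k1 k2.
have -> : \sum_(r <- J) f r =
    (\sum_(r <- J) complex.Re (f r)) +i* (\sum_(r <- J) complex.Im (f r)).
  elim/big_ind3: _ => // [x1 x2 x3 y1 y2 y3 -> -> //|r _].
  by case: (f r).
rewrite -nmE ltcR; apply: le_lt_trans (nm_le_ReIm _) _.
by move: k1 k2 => /=; lra.
Qed.

(** Tolerances of the form [n.+1%:R^-1] exist in both [R] and [K], which lets a real tolerance be
    replaced by one in [K]. *)
Lemma inv_nat_le (R : archiRealFieldType) (r : R) :
  0 < r -> exists n, n.+1%:R^-1 <= r.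
Proof.
move=> r0; exists (Num.bound r^-1); rewrite invf_ple ?posrE // ltW //.
apply: lt_le_trans (archi_boundP _) _; first by rewrite invr_ge0 ltW.
by rewrite ler_nat.
Qed.

(** * Transfer from the scalars [K] to [R[i]] along a norm-preserving embedding *)

Section Transfer.
Variables (R : realType) (K : numFieldType) (kappa : {rmorphism K -> R[i]}).
Hypothesis nm_kappa : forall z, (nm (kappa z))%:C = kappa `|z|.
Hypothesis K_complete : abs_complete K.

Definition re (z : K) : R := complex.Re (kappa z).

Lemma re_norm z : re `|z| = nm (kappa z).
Proof. by rewrite /re -nm_kappa. Qed.

Lemma reB z z' : re (z - z') = re z - re z'.
Proof. by rewrite /re rmorphB; case: (kappa z) (kappa z') => ? ? []. Qed.

(** A nonnegative difference equals its own norm, and [kappa] is known to respect norms. *)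
Lemma re_le z z' : z <= z' -> re z <= re z'.
Proof.
by move=> zz'; rewrite -subr_ge0 -reB -[z' - z]ger0_norm ?subr_ge0 // re_norm nm_ge0.
Qed.

Lemma re_sum (I : Type) (r : seq I) (F : I -> K) :
  re (\sum_(i <- r) F i) = \sum_(i <- r) re (F i).
Proof.
rewrite /re rmorph_sum /=; elim/big_ind2: _ => // x1 x2 y1 y2 <- <-.
by case: x2 y2 => ? ? [].
Qed.

Lemma re_abs_le z : `|re z| <= re `|z|.
Proof. by rewrite re_norm; apply: Re_le_nm. Qed.

Lemma re_nat_inv (n : nat) : re n%:R^-1 = n%:R^-1.
Proof. by rewrite /re fmorphV rmorph_nat -(rmorph_nat (real_complex R)) -fmorphV. Qed.

Variables (G : zmodType) (iota : {additive G -> R}) (e : G).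
Hypothesis iota_e : iota e = 1.
Implicit Types (x y u v : G -> K).

Lemma kappa_wave N (c : K) g : kappa (wave e N c g) = wave e N (kappa c) g.
Proof.
by rewrite /wave rmorphM fmorphV rmorph_nat !rmorphD rmorphM rmorphB !rmorph_nat.
Qed.

Lemma ell1_finite_support (S : {fset G}) x :
  (forall r, r \notin S -> x r = 0) -> ell1 x.
Proof.
move=> x0; exists (\sum_(r <- S) `|x r|) => J; rewrite partial_sumE.
have SJ : (S `<=` S `|` J)%fset by apply: fsubsetUl.
rewrite (big_fset_incl _ SJ) => [|r _ /x0 ->]; last by rewrite normr0.
by apply: fsum_le; [move=> r|apply: fsubsetUr].
Qed.

Lemma ell1B x y : ell1 x -> ell1 y -> ell1 (x - y).
Proof.
move=> [M hM] [M' hM']; exists (M + M') => J.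
have := lerD (hM J) (hM' J); rewrite !partial_sumE -big_split /=.
by apply: le_trans; apply: ler_sum => r _; apply: ler_normB.
Qed.

(** The partial sums of norms increase with [J], hence stay below their limit, which exists by
    [K_complete]. *)
Lemma ell1_norm_ge x (J : {fset G}) : ell1 x ->
  \sum_(r <- J) nm (kappa (x r)) <= re (ell1_norm x).
Proof.
move=> [M hM].
have /cvg_totallyP lim_x : partial_sum (fun g => `|x g| : K^o) @ totally
    --> (ell1_norm x : K^o).
  apply: (K_complete (f := fun g => `|x g|) (M := M)) => J'.
  under eq_bigr do rewrite normr_id.
  by rewrite -partial_sumE.
rewrite (eq_bigr (fun r => re `|x r|)) => [|r _]; last by rewrite re_norm.
rewrite -re_sum; apply/ler_addgt0Pl => rho rho0.
have [n n_rho] := inv_nat_le rho0.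
have n0 : 0 < n.+1%:R^-1 :> K by rewrite invr_gt0 ltr0n.
have [J0 /(_ (J0 `|` J)%fset (fsubsetUl _ _)) hJ0] := lim_x _ n0.
have := re_le (ltW hJ0); rewrite re_nat_inv => h.
have := le_trans (re_abs_le _) h; rewrite reB partial_sumE ler_norml => /andP[+ _].
have : re (\sum_(r <- J) `|x r|) <= re (\sum_(r <- (J0 `|` J)%fset) `|x r|).
  by apply: re_le; apply: fsum_le => //; apply: fsubsetUr.
move: (re _) (re (\sum_(r <- (J0 `|` J)%fset) _)) (re _) n_rho => b c d.
by move: (n.+1%:R^-1 : R) => s; lra.
Qed.

(** Since [v] is bounded, the family of products is absolutely summable. *)
Lemma convolution_cvg u v p : ell1 u -> ell1 v ->
  forall rho : R, 0 < rho -> exists J0 : {fset G}, forall J : {fset G},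
  (J0 `<=` J)%fset ->
  nm (\sum_(r <- J) kappa (u r) * kappa (v (p - r)) - kappa (convolution u v p)) <= rho.
Proof.
move=> [M hM] [M' hM'] rho rho0.
have vM' r : `|v r| <= M'.
  by have := hM' [fset r]%fset; rewrite partial_sumE big_seq_fset1.
have M'0 : 0 <= M' by apply: le_trans (vM' 0).
have /cvg_totallyP lim_uv : partial_sum (fun r => u r * v (p - r) : K^o) @ totally
    --> (convolution u v p : K^o).
  apply: (K_complete (f := fun r => u r * v (p - r)) (M := M * M')) => J.
  apply: (@le_trans _ _ ((\sum_(r <- J) `|u r|) * M')).
    by rewrite mulr_suml; apply: ler_sum => r _; rewrite normrM ler_wpM2l.
  by rewrite ler_wpM2r // -partial_sumE.
have [n n_rho] := inv_nat_le rho0.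
have n0 : 0 < n.+1%:R^-1 :> K by rewrite invr_gt0 ltr0n.
have [J0 hJ0] := lim_uv _ n0; exists J0 => J /hJ0 /ltW /re_le.
rewrite re_nat_inv re_norm partial_sumE rmorphB rmorph_sum nm_distC => h.
apply: le_trans n_rho; apply: le_trans h.
by under [in leRHS]eq_bigr do rewrite rmorphM.
Qed.

Lemma not_uniformly_open : ~ ell1_uniformly_open_mul K G.
Proof.
move=> /(_ (4^-1)); rewrite invr_gt0 ltr0n => /(_ isT)[delta delta0 hopen].
have kdelta : kappa delta = (re delta)%:C.
  by rewrite -[delta]ger0_norm ?ltW // re_norm -nm_kappa.
have rdelta0 : 0 < re delta / 2.
  rewrite divr_gt0 // -[delta]ger0_norm ?(ltW delta0) // re_norm lt_def nm_ge0 andbT.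
  apply/eqP => /Normc.eq0_normc /eqP; rewrite fmorph_eq0.
  by rewrite gt_eqF.
have [N N1 noN] := no_uniform_factorization rdelta0.
pose x : G -> K := wave e N 1; pose y : G -> K := wave e N (-1).
pose S := wave_supp e N.
(* Half of [delta], because the ball is open. *)
pose h p := \sum_(r <- S) x r * y (p - r) + (p == 0)%:R * (delta / 2).
have convE p : convolution x y p = \sum_(r <- S) x r * y (p - r).
  by apply: sum_finite_support => r /wave_out; rewrite /x => ->; rewrite mul0r.
have ell1x : ell1 x by apply: (@ell1_finite_support S) => r; apply: wave_out.
have ell1y : ell1 y by apply: (@ell1_finite_support S) => r; apply: wave_out.
have ell1h : ell1 h.
  apply: (@ell1_finite_support [fset z in 0 :: [seq (r + s)%R | r <- S, s <- S]]%fset).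
  move=> p; rewrite !inE negb_or => /andP[/negbTE p0 pS].
  rewrite /h p0 mul0r addr0 big_seq big1 // => r rS.
  have [prS|/wave_out] := boolP (p - r \in S); last by rewrite /y => ->; rewrite mulr0.
  by case/negP: pS; apply/allpairsP; exists (r, p - r); rewrite /= [RHS]addrC subrK.
have convBh p : (convolution x y - h) p = - ((p == 0)%:R * (delta / 2)).
  transitivity (convolution x y p - h p); first by [].
  by rewrite convE /h opprD addrA subrr add0r.
have hball : ball_in (@ell1 K G) (@ell1_norm K G) (convolution x y) delta h.
  split => //=; rewrite /ell1_norm (@sum_finite_support _ _ _ [fset 0]%fset).
    rewrite big_seq_fset1 convBh eqxx mul1r normrN.
    rewrite ger0_norm ?divr_ge0 ?(ltW delta0) //.
    by rewrite ltr_pdivrMr // mulr_natr mulr2n ltrDl.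
  by move=> p; rewrite inE convBh => /negbTE ->; rewrite mul0r oppr0 normr0.
have [u [ell1u hu] [v [ell1v hv] huv]] := hopen x y ell1x ell1y h hball.
have bound f g : ell1 f -> ell1 g -> ell1_norm (f - g) < 4^-1 ->
    forall J : {fset G}, \sum_(r <- J) nm (kappa (g r) - kappa (f r)) <= 1 / 4.
  move=> f1 g1 fg J; have := ell1_norm_ge J (ell1B f1 g1).
  have := re_le (ltW fg); rewrite re_nat_inv.
  under eq_bigr do rewrite fctE rmorphB nm_distC.
  by lra.
apply: (noN G iota e (kappa \o u) (kappa \o v) iota_e).
- by move=> J; have := bound _ _ ell1x ell1u hu J;
    under eq_bigr do rewrite kappa_wave rmorph1.
- by move=> J; have := bound _ _ ell1y ell1v hv J;
    under eq_bigr do rewrite kappa_wave rmorphN1.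
- move=> p rho rho0; have [J0 HJ] := convolution_cvg p ell1u ell1v rho0.
  exists J0 => J /HJ; rewrite huv /h.
  rewrite rmorphD rmorph_sum rmorphM rmorph_nat fmorph_div rmorph_nat kdelta.
  under [X in _ - (X + _)]eq_bigr do rewrite rmorphM !kappa_wave rmorph1 rmorphN1.
  by rewrite (_ : (re delta / 2)%:C = (re delta)%:C / 2) // fmorph_div rmorph_nat.
Qed.

End Transfer.

Theorem corollary4p13 (R : realType) :
  (~ ell1_uniformly_open_mul R int /\ ~ ell1_uniformly_open_mul R rat) /\
  (~ ell1_uniformly_open_mul R[i] int /\ ~ ell1_uniformly_open_mul R[i] rat).
Proof.
have nm_real_complex (z : R) : (nm z%:C)%:C = (`|z|)%:C by rewrite nm_real.
have nm_id (z : R[i]) : (nm z)%:C = `|z| by [].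
have iZ : (intr : int -> R) 1 = 1 by [].
have iQ : (ratr : rat -> R) 1 = 1 by rewrite rmorph1.
split; split.
(* Real scalars are embedded by [real_complex], complex ones by the identity; the additive maps
   [intr] and [ratr] take the value 1 at [e = 1]. *)
- exact: (@not_uniformly_open R R (real_complex R) nm_real_complex
            (@abs_complete_real R) int intr 1 iZ).
- exact: (@not_uniformly_open R R (real_complex R) nm_real_complex
            (@abs_complete_real R) rat ratr 1 iQ).
- exact: (@not_uniformly_open R R[i] idfun nm_id
            (@abs_complete_complex R) int intr 1 iZ).
- exact: (@not_uniformly_open R R[i] idfun nm_id
            (@abs_complete_complex R) rat ratr 1 iQ).
Qed.
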